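(* Let $\mathbf{n}=(n_1,\dots,n_k)\in\mathbb{Z}_{>0}^k$ and assume $n_1\ge n_2\ge\dots\ge n_k$. If $\frac{n_j}{n_{j+1}}\ge\frac{2k}{k-1}$ for all $2\le j\le k-2$, and $\gcd(n_{k-1},n_k)\le\frac{k-1}{k+1}(n_{k-1}-n_k)$, then $\mathbf{n}$ is a lonely runner instance.
   Context: A vector $\mathbf{n}\in\mathbb{Z}_{>0}^k$ is a lonely runner instance if there exists a real number $t$ such that for all $1\le j\le k$ the distance of $tn_j$ to the nearest integer is at least $\frac{1}{k+1}$. *)

(* Defs.v *)
From mathcomp Require Import all_boot all_order all_algebra.
From mathcomp Require Import reals.

Set Implicit Arguments.
Unset Strict Implicit.
Unset Printing Implicit Defensive.

Import Order.TTheory GRing.Theory Num.Theory.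
Local Open Scope ring_scope.

(* 1-based access: [entry n j] is n_j for 1 <= j <= k, where
   n = (n_1, ..., n_k); values of [j] outside that range are junk. *)
Definition entry (k : nat) (n : k.-tuple nat) (j : nat) : nat :=
  nth 0%N n j.-1.

Definition dist_nearest_int (R : realType) (x : R) : R :=
  Num.min (x - (Num.floor x)%:~R) ((Num.ceil x)%:~R - x).

Lemma dist_nearest_int_le (R : realType) (x : R) (m : int) :
  dist_nearest_int x <= `|x - m%:~R|.
Proof.
rewrite /dist_nearest_int ge_min; have [mx|xm] := leP m%:~R x.
  by rewrite ger0_norm ?subr_ge0// lerB // ler_int floor_ge_int mx.
rewrite distrC gtr0_norm ?subr_gt0//; apply/orP; right.
by rewrite lerB // ler_int ceil_le_int ltW.
Qed.

Lemma dist_nearest_int_attained (R : realType) (x : R) :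
  exists m : int, dist_nearest_int x = `|x - m%:~R|.
Proof.
rewrite /dist_nearest_int; case: leP => _.
  by exists (Num.floor x); rewrite ger0_norm ?subr_ge0 ?floor_le.
by exists (Num.ceil x); rewrite distrC ger0_norm ?subr_ge0 ?ceil_ge.
Qed.

Definition lonely_runner_instance (R : realType) (k : nat) (n : k.-tuple nat) : Prop :=
  exists t : R, forall j : nat, (1 <= j <= k)%N ->
    1 / (k%:R + 1) <= dist_nearest_int (t * (entry n j)%:R).

(* Main.v *)
Require Import Defs.
From mathcomp Require Import all_boot all_order all_algebra.
From mathcomp Require Import reals.
From mathcomp Require Import zify ring lra.

Import Order.TTheory GRing.Theory Num.Theory.
Local Open Scope ring_scope.

(** With d = 1/(k+1), runner j is far from 0 exactly while t * n_j lies in a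
    window [a + d, a + 1 - d] with a an integer.  The gcd condition produces a
    multiple a n_k - b n_(k-1) of the gcd in an interval of length
    (1 - 2d)(n_(k-1) - n_k), which says that the a-th window of runner k-1 is
    contained in the b-th window of runner k.  The ratio condition makes every
    window of runner j+1 long enough to contain a complete window of runner j;
    descending from j = k-2 to j = 2 leaves a window of runner 2, which is at
    least as long as the gap between two consecutive windows of runner 1. *)

Definition in_window {R : realType} (d : R) (a : int) (x : R) : bool :=
  a%:~R + d <= x <= a%:~R + 1 - d.

Lemma in_window_dist {R : realType} (d : R) (a : int) (x : R) :
  in_window d a x -> d <= dist_nearest_int x.
Proof.
move=> /andP[ax xa]; have [m ->] := dist_nearest_int_attained x.
have [ma|am] := lerP m a.
  have : m%:~R <= a%:~R :> R by rewrite ler_int.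
  by move=> ?; apply: le_trans (ler_norm _); lra.
have : (a + 1)%:~R <= m%:~R :> R by rewrite ler_int lezD1.
by rewrite intrD distrC => ?; apply: le_trans (ler_norm _); lra.
Qed.

Lemma exists_int_ceil {R : realType} (x : R) :
  exists a : int, x <= a%:~R < x + 1.
Proof.
exists (Num.ceil x); rewrite ceil_ge /=.
by have := ceilB1_lt x; rewrite intrD; lra.
Qed.

(** Windows of speed [q] recur with period 1/q and last (1-2d)/q, so any time interval of length
    (2-2d)/q contains a complete one; the hypothesis says that a window of speed [p] lasts that
    long. *)
Lemma window_refine {R : realType} (d p q : R) (a : int) :
  0 < p -> 0 < q -> (2 - 2 * d) * p <= (1 - 2 * d) * q ->
  exists b : int, forall t : R, in_window d b (t * q) -> in_window d a (t * p).
Proof.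
move=> p0 q0 pq; have [b /andP[lb ub]] := exists_int_ceil ((a%:~R + d) * q / p - d).
have {}lb : (a%:~R + d) * q <= (b%:~R + d) * p.
  by rewrite -ler_pdivrMr //; lra.
have {}ub : (b%:~R + d - 1) * p <= (a%:~R + d) * q.
  by rewrite -ler_pdivlMr //; lra.
exists b => t /andP[bt tb]; apply/andP.
have lt : (b%:~R + d) * p <= t * q * p by rewrite ler_pM2r.
have ut : t * q * p <= (b%:~R + 1 - d) * p by rewrite ler_pM2r.
by split; rewrite -(ler_pM2r q0); nra.
Qed.

(** A window of speed [p] lasts (1-2d)/p >= (1-2d)/q, and d <= 1/4 makes this at least the gap 2d/q
    between windows of speed [q]. *)
Lemma window_meets {R : realType} (d p q : R) (a : int) :
  0 <= d <= 1 / 4 -> 0 < p -> p <= q ->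
  exists (b : int) (t : R), in_window d a (t * p) /\ in_window d b (t * q).
Proof.
move=> /andP[d0 d4] p0 pq; have q0 : 0 < q by exact: lt_le_trans pq.
have [p_neq0 q_neq0] : p != 0 /\ q != 0 by rewrite !gt_eqF.
have dpq : d * p <= d * q by rewrite ler_wpM2l.
have dq4 : 4 * (d * q) <= q by nra.
(* [c] is the position of runner [q] when the window of runner [p] opens, and [b] is its first
   window not over by then. If that one is yet to open, runner [q] has at most 2d to cover. *)
pose c := (a%:~R + d) * q / p.
have cp : c * p = (a%:~R + d) * q by rewrite /c mulfVK.
have [b /andP[lb ub]] := exists_int_ceil (c + d - 1); exists b.
have [cb|bc] := lerP c (b%:~R + d).
  exists ((b%:~R + d) / q); split; last first.
    by rewrite mulfVK //; apply/andP; split; lra.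
  have lt : c * p <= (b%:~R + d) * p by rewrite ler_pM2r.
  have ut : (b%:~R + d) * p <= (c + 2 * d) * p by rewrite ler_pM2r //; lra.
  by rewrite mulrAC /in_window ler_pdivlMr // ler_pdivrMr //; apply/andP; split; lra.
exists (c / q); rewrite mulfVK // mulrAC cp mulfK //.
by split; apply/andP; split; lra.
Qed.

Lemma exists_window_subset {R : realType} (d : R) (N M : nat) :
  (0 < N)%N -> (0 < M)%N ->
  (gcdn N M)%:R <= (1 - 2 * d) * (N%:R - M%:R) ->
  exists a b : int, forall t : R,
    in_window d a (t * N%:R) -> in_window d b (t * M%:R).
Proof.
move=> N0 M0 gNM.
have g0 : 0 < (gcdn N M)%:R :> R by rewrite ltr0n gcdn_gt0 N0.
(* The containment follows from d(N-M) <= aM - bN <= (1-d)(N-M); [z] picks the first multiple of the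
   gcd at or past the lower end. *)
have [z /andP[lz uz]] := exists_int_ceil (d * (N%:R - M%:R) / (gcdn N M)%:R).
have {}lz : d * (N%:R - M%:R) <= z%:~R * (gcdn N M)%:R by rewrite -ler_pdivrMr.
have {}uz : z%:~R * (gcdn N M)%:R <= (1 - d) * (N%:R - M%:R).
  have : (z%:~R - 1) * (gcdn N M)%:R <= d * (N%:R - M%:R).
    by rewrite -ler_pdivlMr //; lra.
  lra.
have [u [v uv]] := Bezoutz N M.
have {}uv : u%:~R * N%:R + v%:~R * M%:R = (gcdn N M)%:R :> R.
  by move/(congr1 (intr : int -> R)): uv; rewrite intrD !intrM.
(* Bezout coefficients scaled by [z] make aM - bN equal to [z] times the gcd. *)
exists (z * v), (- (z * u)) => t /andP[]; rewrite /in_window !(intrM, rmorphN) /= => ta at'.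
have N0' : 0 < N%:R :> R by rewrite ltr0n.
have M0' : 0 < M%:R :> R by rewrite ltr0n.
have lt : (z%:~R * v%:~R + d) * M%:R <= t * N%:R * M%:R by rewrite ler_pM2r.
have ut : t * N%:R * M%:R <= (z%:~R * v%:~R + 1 - d) * M%:R by rewrite ler_pM2r.
by apply/andP; split; rewrite -(ler_pM2r N0'); rewrite -uv in lz uz; lra.
Qed.

Theorem theorem8 (R : realType) (k : nat) (n : k.-tuple nat)
  (k_ge2 : (2 <= k)%N)
  (n_pos : forall j : nat, (1 <= j <= k)%N -> (0 < entry n j)%N)
  (n_mono : forall j : nat, (1 <= j < k)%N -> (entry n j.+1 <= entry n j)%N)
  (n_ratio : forall j : nat, (2 <= j <= k - 2)%N ->
     2 * k%:R / (k%:R - 1) <= (entry n j)%:R / (entry n j.+1)%:R :> R)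
  (n_gcd : (gcdn (entry n (k - 1)) (entry n k))%:R
     <= (k%:R - 1) / (k%:R + 1)
        * ((entry n (k - 1))%:R - (entry n k)%:R) :> R) :
  lonely_runner_instance R n.
Proof.
pose d : R := 1 / (k%:R + 1).
have k2 : 2 <= k%:R :> R by rewrite ler_nat.
have dk : d * (k%:R + 1) = 1 by rewrite /d; field; lra.
have n0 j : (1 <= j <= k)%N -> 0 < (entry n j)%:R :> R by rewrite ltr0n; exact: n_pos.
(* The second premise stops the descent at runner 2, where the ratio hypothesis ends; allowing
   [i = 0] covers k = 2, when runner k-1 is runner 1. *)
have nested i : (i < k - 1)%N -> (i = 0 \/ i < k - 2)%N ->
    exists a : int, forall t : R, in_window d a (t * (entry n (k - 1 - i))%:R) ->
    forall j, (k - 1 - i <= j <= k)%N -> exists b : int, in_window d b (t * (entry n j)%:R).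
  elim: i => [_ _|i IH ik i0].
    have [|||a [b ab]] := @exists_window_subset R d (entry n (k - 1)) (entry n k).
    - by apply: n_pos; lia.
    - by apply: n_pos; lia.
    - by rewrite (_ : 1 - 2 * d = (k%:R - 1) / (k%:R + 1)) // /d; field; lra.
    exists a => t; rewrite subn0 => ta j /andP[jk kj].
    have [->|jk'] := eqVneq j k; first by exists b; exact: ab.
    by exists a; rewrite (_ : j = k - 1)%N //; lia.
  have [||a aP] := IH; [lia|lia|].
  set J := (k - 1 - i.+1)%N; have SJ : (k - 1 - i)%N = J.+1 by rewrite /J; lia.
  rewrite SJ in aP.
  have J2 : (2 <= J <= k - 2)%N by rewrite /J; lia.
  have [|||b bP] := @window_refine R d (entry n J.+1)%:R (entry n J)%:R a.
  - by apply: n0; lia.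
  - by apply: n0; lia.
  - have n1 : 0 < (entry n J.+1)%:R :> R by apply: n0; lia.
    (* The ratio bound 2k/(k-1) is exactly (2-2d)/(1-2d). *)
    have r : (2 - 2 * d) = (1 - 2 * d) * (2 * k%:R / (k%:R - 1)).
      by rewrite /d; field; apply/andP; split; lra.
    rewrite r -mulrA ler_pM2l; last by nra.
    by rewrite -ler_pdivlMr //; exact: n_ratio.
  exists b => t tb j /andP[Jj jk].
  have [->|jJ] := eqVneq j J; first by exists b.
  by apply: (aP t (bP t tb)); lia.
have [t tP] : exists t : R, forall j, (1 <= j <= k)%N ->
    exists b : int, in_window d b (t * (entry n j)%:R).
  (* [window_meets] needs d <= 1/4, that is k >= 3. For k = 2 the nested window already covers both
     runners, and its opening instant serves as [t]. *)
  have [k3|k3] := ltnP 2 k; last first.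
    have [||a aP] := nested 0%N; [lia|by left|rewrite subn0 in aP].
    have n1 : 0 < (entry n (k - 1))%:R :> R by apply: n0; lia.
    exists ((a%:~R + d) / (entry n (k - 1))%:R) => j jk; apply: aP; last by lia.
    by rewrite mulfVK ?gt_eqF //; apply/andP; split; nra.
  have [||a aP] := nested (k - 3)%N; [lia|lia|].
  rewrite (_ : k - 1 - (k - 3) = 2)%N in aP; last by lia.
  have k3' : 3 <= k%:R :> R by rewrite ler_nat.
  have [||| b [t [ta tb]]] := @window_meets R d (entry n 2)%:R (entry n 1)%:R a.
  - by apply/andP; split; nra.
  - by apply: n0; lia.
  - by rewrite ler_nat; apply: n_mono; lia.
  exists t => j /andP[j1 jk]; have [->|j1'] := eqVneq j 1%N; first by exists b.
  by apply: aP => //; lia.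
by exists t => j /tP[b]; exact: in_window_dist.
Qed.
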